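(* There are absolute constants $a,b>0$ such that the following holds. Let $d$ be a positive integer and $\epsilon\in(0,1/2)$. Let $k\leq l<d/3$ be integers with $k\cdot l<d\ln(1/(3\epsilon))/3$. Let $\lambda$ be the uniform distribution over subsets $x\subseteq[d]$ of size $k$, and $\rho$ the uniform distribution over subsets $y\subseteq[d]$ of size $l$. For any deterministic protocol $\pi$ for set disjointness over $\lambda\times\rho$ with $\epsilon$ type II error, either Alice sends at least $a k$ bits or Bob sends at least $b l$ bits.
   Context: Set disjointness: $f(x,y)=1$ iff $x\cap y=\emptyset$. A deterministic two-party protocol $\pi$ (Alice holds $x$, Bob holds $y$) for $f$ over $\lambda\times\rho$ has $\epsilon$ error if $\Pr_{x\sim\lambda,y\sim\rho}[\pi(x,y)\neq f(x,y)]\leq\epsilon$; it has type II error if it can be incorrect only when $f(x,y)=1$. The paper states the conclusion as ''either $a=\Omega(k)$ or $b=\Omega(l)$'' where $a,b$ are the numbers of bits sent by Alice and Bob. *)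

(* Defs.v *)
From HB Require Import structures.
From mathcomp Require Import all_boot all_order all_algebra.
From mathcomp Require Import reals exp.
Set Implicit Arguments.
Unset Strict Implicit.
Unset Printing Implicit Defensive.
Import Order.TTheory GRing.Theory Num.Theory.
Local Open Scope ring_scope.

(* Deterministic two-party protocol trees. At an internal node the owner sends
   the bit computed from its own input; the protocol then continues with the
   first subtree on bit [true] and with the second one on bit [false]. *)
Inductive protocol (X Y : Type) : Type :=
  | Output of bool
  | AliceSends of (X -> bool) & protocol X Y & protocol X Y
  | BobSends of (Y -> bool) & protocol X Y & protocol X Y.

Section Protocols.
Variables X Y : Type.

Fixpoint output (pi : protocol X Y) (x : X) (y : Y) : bool :=
  match pi with
  | Output r => r
  | AliceSends g p1 p0 => if g x then output p1 x y else output p0 x y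
  | BobSends g p1 p0 => if g y then output p1 x y else output p0 x y
  end.

Fixpoint alice_bits (pi : protocol X Y) (x : X) (y : Y) : nat :=
  match pi with
  | Output _ => 0%N
  | AliceSends g p1 p0 =>
      (if g x then alice_bits p1 x y else alice_bits p0 x y).+1
  | BobSends g p1 p0 => if g y then alice_bits p1 x y else alice_bits p0 x y
  end.

Fixpoint bob_bits (pi : protocol X Y) (x : X) (y : Y) : nat :=
  match pi with
  | Output _ => 0%N
  | AliceSends g p1 p0 => if g x then bob_bits p1 x y else bob_bits p0 x y
  | BobSends g p1 p0 =>
      (if g y then bob_bits p1 x y else bob_bits p0 x y).+1
  end.

End Protocols.

Section Distributional.
Variables (R : realType) (X Y : finType).
Implicit Types (lambda : X -> R) (rho : Y -> R) (f : X -> Y -> bool).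

Definition Pr_prod lambda rho (E : X -> Y -> bool) : R :=
  \sum_(x : X) \sum_(y : Y | E x y) lambda x * rho y.

Definition has_error lambda rho f (eps : R) (pi : protocol X Y) : Prop :=
  Pr_prod lambda rho (fun x y => output pi x y != f x y) <= eps.

(* The inputs of a protocol over [lambda x rho] are the pairs in the support
   of this product distribution; both the one-sidedness of the error and the
   worst-case communication are relative to these inputs. *)
Definition is_input lambda rho (x : X) (y : Y) : bool :=
  (0 < lambda x) && (0 < rho y).

Definition errs_only_on_ones lambda rho f (pi : protocol X Y) : Prop :=
  forall x y, is_input lambda rho x y -> output pi x y != f x y -> f x y.

Definition has_typeII_error lambda rho f (eps : R) (pi : protocol X Y) : Prop :=
  has_error lambda rho f eps pi /\ errs_only_on_ones lambda rho f pi.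

Definition alice_cost lambda rho (pi : protocol X Y) : nat :=
  \max_(p : X * Y | is_input lambda rho p.1 p.2) alice_bits pi p.1 p.2.

Definition bob_cost lambda rho (pi : protocol X Y) : nat :=
  \max_(p : X * Y | is_input lambda rho p.1 p.2) bob_bits pi p.1 p.2.

End Distributional.

Definition set_disjointness (d : nat) (x y : {set 'I_d}) : bool :=
  [disjoint x & y].

Definition uniform_on (R : realType) (T : finType) (A : {set T}) (t : T) : R :=
  if t \in A then #|A|%:R^-1 else 0.

Definition uniform_subsets (R : realType) (d k : nat) : {set 'I_d} -> R :=
  uniform_on R [set x : {set 'I_d} | #|x| == k].

Arguments uniform_subsets R d k : clear implicits.

(* Main.v *)
Require Import Defs.
From HB Require Import structures.
From mathcomp Require Import all_boot all_order all_algebra.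
From mathcomp Require Import reals sequences exp.
From mathcomp Require Import zify lra.
Import Order.TTheory GRing.Theory Num.Theory.
Local Open Scope ring_scope.

(** Write [A], [B] for the two costs and [D = 'C(d - l, k)] for the number of
    [k]-sets disjoint from a given [l]-set.  The hypothesis on [k * l] says that
    a random pair is disjoint with probability more than [3 * eps], so for at
    least a third of the sets [y] the protocol accepts at least half of the [D]
    sets [x] disjoint from [y].  By the richness argument it then accepts a
    rectangle [S x T] with [#|S| >= D / 2 ^ (A + 1)] and
    [#|T| >= 'C(d, l) / (3 * 2 ^ (A + B))].  As false acceptances are excluded,
    the unions [U] of [S] and [V] of [T] are disjoint.  If [A] and [B] are small
    with respect to [l], the size of [T] forces [#|V| > 15 d / 16]; hence
    [#|U| < d / 16] and [#|S| <= 'C(d, k) / 16 ^ k], which is too small because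
    ['C(d, k) <= 2 ^ k * D].  For bounded [l] the factor [3 * 2 ^ (A + B)] is too
    large for this, but then both costs vanish and the protocol accepts every
    pair, including intersecting ones. *)

(** * Binomial coefficients and families of sets of fixed size *)

(** Once the factorial of [k] is cleared, both sides are products of [k] factors, compared one by
    one. *)
Lemma ler_expM_bin (R : realFieldType) (a b : R) (m n k : nat) :
  0 <= a ->
  (forall i, (i < k)%N -> a * (m - i)%:R <= b * (n - i)%:R) ->
  a ^+ k * 'C(m, k)%:R <= b ^+ k * 'C(n, k)%:R.
Proof.
move=> a0 ab.
have k0 : 0 < (k`!)%:R :> R by rewrite ltr0n fact_gt0.
rewrite -(ler_pM2r k0) -!mulrA -!natrM !bin_ffact !ffact_prod !natr_prod.
have expE c : c ^+ k = \prod_(i < k) c :> R by rewrite prodr_const card_ord.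
rewrite !expE -!big_split /=.
by apply: ler_prod => i _; rewrite mulr_ge0 //= ab.
Qed.

Lemma leq_expM_bin (a b m n k : nat) :
  (forall i, (i < k)%N -> (a * (m - i) <= b * (n - i))%N) ->
  (a ^ k * 'C(m, k) <= b ^ k * 'C(n, k))%N.
Proof.
move=> ab; rewrite -(ler_nat rat) !natrM !natrX; apply: ler_expM_bin => // i ik.
by rewrite -!natrM ler_nat ab.
Qed.

Lemma leq_card_draws (T : finType) (F : {set {set T}}) (n k : nat) :
  {in F, forall B : {set T}, #|B| = k} -> (#|cover F| <= n)%N ->
  (#|F| <= 'C(n, k))%N.
Proof.
move=> Fk Un; apply: leq_trans (leq_bin2l k Un); rewrite -cards_draws.
apply: subset_leq_card; apply/subsetP => B BF.
by rewrite inE Fk // eqxx andbT /cover (bigcup_sup B).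
Qed.

Lemma card_draws_disjoint (d k : nat) (y : {set 'I_d}) :
  #|[set x : {set 'I_d} | (#|x| == k) && [disjoint x & y]]|
  = 'C(d - #|y|, k).
Proof.
have -> : (d - #|y|)%N = #|~: y| by rewrite [RHS]cardsCs setCK card_ord.
rewrite -cards_draws.
by apply: eq_card => x; rewrite !inE disjoints_subset andbC.
Qed.

Lemma card_split_pred (Z : finType) (Q : {set Z}) (g : Z -> bool) :
  #|Q| = (#|[set z in Q | g z]| + #|[set z in Q | ~~ g z]|)%N.
Proof.
rewrite -(cardsID [set z | g z] Q); congr (_ + _)%N; apply: eq_card => z.
  by rewrite !inE.
by rewrite !inE andbC.
Qed.

(** * The richness argument *)

Section Richness.
Variables X Y : finType.
Implicit Types (p : protocol X Y) (S : {set X}) (T : {set Y}).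

Definition accepted p S (y : Y) : {set X} := [set x in S | output p x y].

(** Rows, columns, threshold [u] and bit bounds are all quantified, since each may change on passing
    to a subtree. *)
Definition rich_rectangle p : Prop :=
  forall S T (u A B : nat),
  (0 < u)%N -> (0 < #|T|)%N ->
  {in T, forall y, u <= #|accepted p S y|}%N ->
  (forall x y, x \in S -> y \in T ->
     alice_bits p x y <= A /\ bob_bits p x y <= B)%N ->
  exists S' T', [/\ S' \subset S, T' \subset T,
    (u <= 2 ^ A * #|S'|)%N, (#|T| <= 2 ^ (A + B) * #|T'|)%N
    & {in S' & T', forall x y, output p x y}].

(* The number of accepted rows halves only when Alice speaks, the number of
   columns whenever somebody speaks. *)
Lemma richness p : rich_rectangle p.
Proof.
elim: p => [r|g p1 IH1 p0 IH0|g p1 IH1 p0 IH0] S T u A B u0 T0 rich cost.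
- have [y yT] := card_gt0P T0.
  exists S, T; split=> //.
  + apply: leq_trans (leq_pmull _ _); last by rewrite expn_gt0.
    apply: leq_trans (rich y yT) _; apply: subset_leq_card.
    by apply/subsetP => x; rewrite inE => /andP[].
  + by apply: leq_pmull; rewrite expn_gt0.
  (* Since [u] is positive, some pair is accepted, so the leaf outputs [true]. *)
  + have : (0 < #|accepted (Output X Y r) S y|)%N := leq_trans u0 (rich y yT).
    by case/card_gt0P => x; rewrite inE => /andP[_ rt] x1 y1 _ _.
- pose S1 := [set x in S | g x]; pose S0 := [set x in S | ~~ g x].
  pose r1 := fun y => (uphalf u <= #|accepted p1 S1 y|)%N.
  (* Both bits are treated alike: [q] is the subtree that follows, [Sq] the rows leading to it, [Tq]
     the columns still rich for it. *)
  have step q (Sq : {set X}) (Tq : {set Y}) :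
      rich_rectangle q ->
      Sq \subset S -> Tq \subset T -> (#|T| <= 2 * #|Tq|)%N ->
      {in Tq, forall y, uphalf u <= #|accepted q Sq y|}%N ->
      (forall x y, x \in Sq ->
        [/\ output (AliceSends g p1 p0) x y = output q x y,
          alice_bits (AliceSends g p1 p0) x y = (alice_bits q x y).+1
          & bob_bits (AliceSends g p1 p0) x y = bob_bits q x y]) ->
      exists S' T', [/\ S' \subset S, T' \subset T,
        (u <= 2 ^ A * #|S'|)%N, (#|T| <= 2 ^ (A + B) * #|T'|)%N
        & {in S' & T', forall x y, output (AliceSends g p1 p0) x y}].
    move=> IH SqS TqT Thalf richq onq.
    have uh0 : (0 < uphalf u)%N by rewrite uphalf_gt0.
    have Tq0 : (0 < #|Tq|)%N by lia.
    have [y yTq] := card_gt0P Tq0.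
    have [x] := card_gt0P (leq_trans uh0 (richq y yTq)).
    rewrite inE => /andP[xSq _].
    have [] := cost x y (subsetP SqS x xSq) (subsetP TqT y yTq).
    have [_ -> _] := onq x y xSq.
    (* A row of [Sq] sends a bit here, so [A] is positive and its predecessor bounds Alice's bits in
       [q]. *)
    case: A cost => // A cost _ _.
    have [|S' [T' [S'S T'T uS' TT' acc]]] := IH Sq Tq (uphalf u) A B uh0 Tq0 richq.
      move=> x' y' x'S y'T.
      have := cost x' y' (subsetP SqS x' x'S) (subsetP TqT y' y'T).
      by have [_ -> ->] := onq x' y' x'S.
    exists S', T'; split.
    + exact: subset_trans S'S SqS.
    + exact: subset_trans T'T TqT.
    + have : (u <= 2 * uphalf u)%N by rewrite mul2n -leq_uphalf_double.
      by rewrite expnS; lia.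
    + by rewrite addSn expnS; lia.
    + move=> x' y' x'S y'T; have [-> _ _] := onq x' y' (subsetP S'S x' x'S).
      exact: acc.
  have split_acc y : #|accepted (AliceSends g p1 p0) S y|
      = (#|accepted p1 S1 y| + #|accepted p0 S0 y|)%N.
    rewrite (card_split_pred _ _ g); congr (_ + _)%N; apply: eq_card => x;
      by rewrite !inE /=; case: (g x); rewrite ?andbT ?andbF.
  have [T1|T1] := leqP #|T| (2 * #|[set y in T | r1 y]|).
  + apply: (step p1 S1 [set y in T | r1 y]) => //.
    * by apply/subsetP => x; rewrite inE => /andP[].
    * by apply/subsetP => x; rewrite inE => /andP[].
    * by move=> y; rewrite inE => /andP[].
    * by move=> x y; rewrite inE /= => /andP[_ ->].
  + have := card_split_pred _ T r1 => cT.
    apply: (step p0 S0 [set y in T | ~~ r1 y]) => //.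
    * by apply/subsetP => x; rewrite inE => /andP[].
    * by apply/subsetP => x; rewrite inE => /andP[].
    * by rewrite cT in T1 *; lia.
    (* If fewer than [uphalf u] of the accepted rows lie in [S1], at least [uphalf u] lie in
       [S0]. *)
    * move=> y; rewrite inE /r1 -ltnNge => /andP[yT lt1].
      have := rich y yT; rewrite split_acc => le.
      by have := uphalf_half u; have := odd_double_half u; lia.
    * by move=> x y; rewrite inE /= => /andP[_ /negbTE->].
- have step q (Tq : {set Y}) :
      rich_rectangle q ->
      Tq \subset T -> (#|T| <= 2 * #|Tq|)%N ->
      (forall x y, y \in Tq ->
        [/\ output (BobSends g p1 p0) x y = output q x y,
          alice_bits (BobSends g p1 p0) x y = alice_bits q x y
          & bob_bits (BobSends g p1 p0) x y = (bob_bits q x y).+1]) ->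
      exists S' T', [/\ S' \subset S, T' \subset T,
        (u <= 2 ^ A * #|S'|)%N, (#|T| <= 2 ^ (A + B) * #|T'|)%N
        & {in S' & T', forall x y, output (BobSends g p1 p0) x y}].
    move=> IH TqT Thalf onq.
    have Tq0 : (0 < #|Tq|)%N by lia.
    have richq : {in Tq, forall y, u <= #|accepted q S y|}%N.
      move=> y yTq; apply: leq_trans (rich y (subsetP TqT y yTq)) _.
      apply: subset_leq_card; apply/subsetP => x.
      by rewrite !inE; have [-> _ _] := onq x y yTq.
    have [y yTq] := card_gt0P Tq0.
    have [x] := card_gt0P (leq_trans u0 (richq y yTq)).
    rewrite inE => /andP[xS _].
    have [] := cost x y xS (subsetP TqT y yTq).
    have [_ _ ->] := onq x y yTq.
    case: B cost => // B cost _ _.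
    have [|S' [T' [S'S T'T uS' TT' acc]]] := IH S Tq u A B u0 Tq0 richq.
      move=> x' y' x'S y'T.
      have := cost x' y' x'S (subsetP TqT y' y'T).
      by have [_ -> ->] := onq x' y' y'T.
    exists S', T'; split=> //.
    + exact: subset_trans T'T TqT.
    + by rewrite addnS expnS; lia.
    + move=> x' y' x'S y'T; have [-> _ _] := onq x' y' (subsetP T'T y' y'T).
      exact: acc.
  have cT := card_split_pred _ T g.
  have [T1|T1] := leqP #|T| (2 * #|[set y in T | g y]|).
  + apply: (step p1 [set y in T | g y]) => //.
    * by apply/subsetP => x; rewrite inE => /andP[].
    * by move=> x y; rewrite inE /= => /andP[_ ->].
  + apply: (step p0 [set y in T | ~~ g y]) => //.
    * by apply/subsetP => x; rewrite inE => /andP[].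
    * by rewrite cT in T1 *; lia.
    * by move=> x y; rewrite inE /= => /andP[_ /negbTE->].
Qed.

End Richness.

(** * Uniform distributions and the probability of disjointness *)

Lemma uniform_on_gt0 (R : realType) (T : finType) (A : {set T}) (t : T) :
  (0 < uniform_on R A t) = (t \in A).
Proof.
rewrite /uniform_on; case: ifP => [tA|_]; last by rewrite ltxx.
by rewrite invr_gt0 ltr0n; apply/card_gt0P; exists t.
Qed.

Lemma Pr_prod_uniform (R : realType) (X Y : finType) (P : {set X}) (Q : {set Y})
    (E : X -> Y -> bool) :
  Pr_prod (uniform_on R P) (uniform_on R Q) E
  = (\sum_(y in Q) #|[set x in P | E x y]|)%:R / (#|P|%:R * #|Q|%:R).
Proof.
rewrite /Pr_prod (exchange_big_dep predT) //= natr_sum mulr_suml.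
rewrite [RHS]big_mkcond; apply: eq_bigr => y _.
rewrite /uniform_on; case: (y \in Q); last by rewrite big1 // => x _; rewrite mulr0.
rewrite -mulr_suml -big_mkcondr sumr_const invfM mulrA; congr (_ * _).
rewrite [RHS]mulr_natl; congr (_ *+ _); apply: eq_card => x.
by rewrite !inE unfold_in /= andbC.
Qed.

(* Markov's inequality: the average of [e] is below [D / 3]. *)
Lemma card_le_half (Y : finType) (Q : {set Y}) (e : Y -> nat) (D : nat) :
  (3 * (\sum_(y in Q) e y) < D * #|Q|)%N ->
  (#|Q| < 3 * #|[set y in Q | (2 * e y <= D)%N]|)%N.
Proof.
move=> h; have cQ := card_split_pred _ Q (fun y => 2 * e y <= D)%N.
set G := #|[set y in Q | (2 * e y <= D)%N]| in cQ *.
set W := #|[set y in Q | ~~ (2 * e y <= D)%N]| in cQ.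
have : (D * W <= 2 * \sum_(y in Q) e y)%N.
  rewrite mulnC -sum_nat_const big_distrr /=.
  rewrite [leqRHS](bigID (fun y => 2 * e y <= D)%N) /=.
  apply: leq_trans (leq_addl _ _).
  rewrite [leqLHS](eq_bigl (fun y => (y \in Q) && ~~ (2 * e y <= D)%N)).
    by apply: leq_sum => y /andP[_]; lia.
  by move=> y; rewrite inE.
by rewrite cQ in h *; nia.
Qed.

(** ['C(d, k) / 'C(d - l, k)] is the product of [1 + l / (d - l - i)] over [i < k]. As
    [d - l - i > d / 3], each factor is at most [expR (3 * l / d)], and the bound on [k * l] keeps
    the product below [1 / (3 * eps)]. *)
Lemma disjoint_prob_gt (R : realType) (d k l : nat) (eps : R) :
  0 < eps -> (k <= l)%N -> (3 * l < d)%N ->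
  k%:R * l%:R < d%:R * ln (1 / (3 * eps)) / 3 ->
  3 * eps * 'C(d, k)%:R < 'C(d - l, k)%:R.
Proof.
move=> eps0 kl ld hkl.
have d0 : 0 < d%:R :> R by rewrite ltr0n; lia.
have e30 : 0 < 3 * eps by lra.
pose t : R := 3 * l%:R / d%:R.
have : expR (k%:R * t) < (3 * eps)^-1.
  rewrite -[ltRHS]lnK ?posrE ?invr_gt0 // ltr_expR -div1r /t mulrA ltr_pdivrMr //.
  by lra.
have : 'C(d, k)%:R <= expR t ^+ k * 'C(d - l, k)%:R.
  have := @ler_expM_bin R 1 (expR t) d (d - l) k ler01.
  rewrite expr1n mul1r; apply=> i ik.
  rewrite mul1r; have m0 : 0 < (d - l - i)%:R :> R by rewrite ltr0n; lia.
  have -> : (d - i)%:R = (1 + l%:R / (d - l - i)%:R) * (d - l - i)%:R :> R.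
    by rewrite mulrDl mul1r divfK ?gt_eqF // -natrD; congr (_%:R); lia.
  rewrite ler_pM2r //; apply: le_trans (expR_ge1Dx _) _.
  rewrite ler_expR /t ler_pdivrMr // mulrAC ler_pdivlMr // -!natrM ler_nat.
  by rewrite mulnAC mulnC leq_mul2r; apply/orP; right; lia.
have D0 : 0 < 'C(d - l, k)%:R :> R by rewrite ltr0n bin_gt0; lia.
rewrite expRM_natl => CD; rewrite -(ltr_pM2r D0) => /(le_lt_trans CD).
by rewrite -(ltr_pM2l e30) mulVKf ?gt_eqF.
Qed.

(** * A large accepted rectangle *)

Lemma bits_le_cost (R : realType) (X Y : finType) (lambda : X -> R)
    (rho : Y -> R) (pi : protocol X Y) (x : X) (y : Y) :
  is_input lambda rho x y ->
  (alice_bits pi x y <= alice_cost lambda rho pi)%N /\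
  (bob_bits pi x y <= bob_cost lambda rho pi)%N.
Proof.
move=> xy; rewrite /alice_cost /bob_cost.
by split; apply: (@leq_bigmax_cond _ (fun p => is_input lambda rho p.1 p.2) _ (x, y)).
Qed.

(** The richness argument starts from the threshold [uphalf D], whence [A.+1], and from more than a
    third of the columns, whence the factor [3]. *)
Lemma accepted_rectangle (R : realType) (d k l : nat) (eps : R)
    (pi : protocol {set 'I_d} {set 'I_d})
    (lambda := uniform_subsets R d k) (rho := uniform_subsets R d l)
    (A := alice_cost lambda rho pi) (B := bob_cost lambda rho pi) :
  (l <= d)%N ->
  3 * eps * 'C(d, k)%:R < 'C(d - l, k)%:R ->
  has_typeII_error lambda rho (@set_disjointness d) eps pi ->
  exists S T : {set {set 'I_d}},
    [/\ {in S, forall x : {set 'I_d}, #|x| = k},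
        {in T, forall y : {set 'I_d}, #|y| = l},
        ('C(d - l, k) <= 2 ^ A.+1 * #|S|)%N,
        ('C(d, l) < 3 * (2 ^ (A + B) * #|T|))%N
      & {in S & T, forall x y : {set 'I_d}, output pi x y}].
Proof.
move=> ld hD [err _].
set P := [set x : {set 'I_d} | #|x| == k].
set Q := [set y : {set 'I_d} | #|y| == l].
have cP : #|P| = 'C(d, k) by rewrite card_draws card_ord.
have cQ : #|Q| = 'C(d, l) by rewrite card_draws card_ord.
set D := 'C(d - l, k) in hD *.
have inputP x y : is_input lambda rho x y = (x \in P) && (y \in Q).
  by rewrite /is_input !uniform_on_gt0.
pose e (y : {set 'I_d}) :=
  #|[set x in P | output pi x y != set_disjointness x y]|.
have Q0 : (0 < 'C(d, l))%N by rewrite bin_gt0.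
have e_small : (3 * (\sum_(y in Q) e y) < D * #|Q|)%N.
  (* Without [k]-sets the error bound cannot be multiplied out, but then the sum is zero and [hD]
     gives [0 < D]. *)
  have [P0|] := posnP 'C(d, k).
    rewrite big1 ?cQ ?muln_gt0 ?Q0 ?andbT.
      by rewrite -(ltr_nat R); rewrite P0 mulr0 in hD.
    by move=> y _; apply: eq_card0 => x; rewrite inE (card0_eq (etrans cP P0)).
  move=> P0; rewrite -(ltr_nat R) !natrM cQ.
  move: err; rewrite /has_error Pr_prod_uniform -/P -/Q cP cQ.
  rewrite ler_pdivrMr; last by rewrite mulr_gt0 // ltr0n.
  move=> le; rewrite -(ltr_pM2r (_ : 0 < 'C(d, l)%:R)) ?ltr0n // in hD.
  by apply: le_lt_trans hD; rewrite -!mulrA ler_pM2l.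
have rich := card_le_half _ _ _ _ e_small.
set T0 := [set y in Q | _] in rich.
have D0 : (0 < D)%N by move: e_small; case: (D).
have acc : {in T0, forall y, uphalf D <= #|accepted _ _ pi P y|}%N.
  move=> y; rewrite !inE => /andP[/eqP yl ey].
  have : (D <= #|accepted _ _ pi P y| + e y)%N.
    rewrite /D -yl -card_draws_disjoint; apply: leq_trans (leq_card_setU _ _).
    apply: subset_leq_card; apply/subsetP => x; rewrite !inE => /andP[-> xy].
    by rewrite /set_disjointness xy; case: (output pi x y).
  by have := uphalf_half D; have := odd_double_half D; lia.
have [||x y xP|S [T [SP TT0 uS TT out]]] := richness _ _ pi P T0 (uphalf D) A B _ _ acc.
- by rewrite uphalf_gt0.
- by lia.
- rewrite inE => /andP[yQ _].
  by apply: bits_le_cost; rewrite inputP xP.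
exists S, T; split=> //.
- by move=> x /(subsetP SP); rewrite inE => /eqP.
- by move=> y /(subsetP TT0); rewrite !inE => /andP[/eqP].
- apply: (@leq_trans (2 * uphalf D)); first by rewrite mul2n -leq_uphalf_double.
  by rewrite expnS -mulnA leq_mul2l uS orbT.
- by rewrite -cQ; apply: leq_trans rich _; rewrite leq_mul2l TT orbT.
Qed.

(** * Disjoint unions and the contradiction *)

Lemma card_disjoint_covers (T : finType) (F G : {set {set T}}) :
  {in F & G, forall x y : {set T}, [disjoint x & y]} ->
  (#|cover F| + #|cover G| <= #|T|)%N.
Proof.
move=> dis; rewrite -cardsUI.
suff -> : cover F :&: cover G = set0 by rewrite cards0 addn0 max_card.
apply/eqP; rewrite setI_eq0; apply/bigcup_disjointP => x xF.
by rewrite disjoint_sym; apply/bigcup_disjointP => y yG; rewrite disjoint_sym dis.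
Qed.

(** Raise the second hypothesis to the power [m]; the remaining [l - n * m] factors only need
    [a <= b]. *)
Lemma leq_expM_exp2 (a b n m l : nat) :
  (a <= b)%N -> (a ^ n * 2 <= b ^ n)%N -> (n * m <= l)%N ->
  (a ^ l * 2 ^ m <= b ^ l)%N.
Proof.
move=> ab h nm; rewrite -{1 2}(subnKC nm) !expnD !expnM mulnAC -expnMn.
have mono x y e : (x <= y)%N -> (x ^ e <= y ^ e)%N.
  by case: e => // e; rewrite leq_exp2r.
by apply: leq_mul; apply: mono.
Qed.

(** [11] is the least [n] with [15 ^ n * 2 <= 16 ^ n]. *)
Lemma leq_exp15_exp16 (m l : nat) :
  (11 * m <= l)%N -> (15 ^ l * 2 ^ m <= 16 ^ l)%N.
Proof. by apply: leq_expM_exp2; lia. Qed.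

Theorem theoremA5 (R : realType) :
  exists a b : R, 0 < a /\ 0 < b /\
    forall (d : nat) (eps : R) (k l : nat),
      (0 < d)%N ->
      0 < eps -> eps < 1 / 2 ->
      (k <= l)%N -> (l%:R : R) < d%:R / 3 ->
      k%:R * l%:R < d%:R * ln (1 / (3 * eps)) / 3 ->
      forall pi : protocol {set 'I_d} {set 'I_d},
        has_typeII_error (uniform_subsets R d k) (uniform_subsets R d l)
          (@set_disjointness d) eps pi ->
        a * k%:R
          <= (alice_cost (uniform_subsets R d k) (uniform_subsets R d l) pi)%:R
        \/ b * l%:R
          <= (bob_cost (uniform_subsets R d k) (uniform_subsets R d l) pi)%:R.
Proof.
(* If both bounds fail, both costs vanish for [l < 100], and [11 * (A + B + 2) <= l] for
   [l >= 100]. *)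
exists 100^-1, 100^-1; do 2![split; first by rewrite invr_gt0].
move=> d eps k l d0 eps0 _ kl ld hkl pi typeII.
have {}ld : (3 * l < d)%N.
  by rewrite -(ltr_nat R) natrM; lra.
have prob := disjoint_prob_gt R d k l eps eps0 kl ld hkl.
have ld' : (l <= d)%N by lia.
have [S [T [Sk Tl cS cT acc]]] := accepted_rectangle R d k l eps pi ld' prob typeII.
have [_ onesided] := typeII.
set A := alice_cost _ _ _ in cS cT *; set B := bob_cost _ _ _ in cT *.
have dis : {in S & T, forall x y : {set 'I_d}, [disjoint x & y]}.
  move=> x y xS yT; apply: contraT => xy.
  have := onesided x y; rewrite /is_input !uniform_on_gt0 !inE Sk // Tl // !eqxx.
  by rewrite acc // /set_disjointness (negbTE xy) => ->.
have [hA|hA] := leqP k (100 * A).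
  by left; rewrite mulrC ler_pdivrMr // -natrM ler_nat mulnC.
have [hB|hB] := leqP l (100 * B).
  by right; rewrite mulrC ler_pdivrMr // -natrM ler_nat mulnC.
exfalso.
have S0 : (0 < #|S|)%N.
  have : (0 < 'C(d - l, k))%N by rewrite bin_gt0; lia.
  by case: #|S| cS => //; lia.
have cover_le := card_disjoint_covers _ _ _ dis; rewrite card_ord in cover_le.
have [V_le|V_gt] := leqP (16 * #|cover T|) (15 * d).
  have [l100|l100] := ltnP l 100.
    have A0 : A = 0%N by lia.
    have B0 : B = 0%N by lia.
    have T0 : (0 < #|T|)%N by case: #|T| cT => //; rewrite !muln0.
    have [x xS] := card_gt0P S0; have [y yT] := card_gt0P T0.
    have xy : is_input (uniform_subsets R d k) (uniform_subsets R d l) x y.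
      by rewrite /is_input !uniform_on_gt0 !inE Sk // Tl // !eqxx.
    (* No bit is sent on [x] and [y], so [pi] is a leaf, and it accepts this pair. *)
    have piE x' y' : output pi x' y'.
      have := bits_le_cost _ _ _ _ _ pi _ _ xy; rewrite -/A -/B A0 B0.
      by have := acc x y xS yT; case: (pi) => [r|g p1 p0|g p1 p0] //= _ [].
    (* Exchanging some [j] in [x] for some [i] in [y] gives a [k]-set that meets [y], yet is
       accepted with it. *)
    have [i iy] : exists i, i \in y by apply/card_gt0P; rewrite Tl //; lia.
    have [j jx] : exists j, j \in x by apply/card_gt0P; rewrite Sk //; lia.
    have ix : i \notin x by rewrite (disjointFl (dis x y xS yT) iy).
    have xk : #|i |: x :\ j| = k.
      by rewrite cardsU1 !inE (negbTE ix) andbF -(Sk x xS) (cardsD1 j x) jx.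
    have := onesided (i |: x :\ j) y.
    rewrite /is_input !uniform_on_gt0 !inE xk Tl // !eqxx piE.
    have -> : set_disjointness (i |: x :\ j) y = false.
      by apply/negP => /disjointFr-/(_ i (setU11 _ _)); rewrite iy.
    by move=> /(_ isT isT).
  (* [T] consists of [l]-subsets of [cover T]; the factor [3] in [cT] is rounded up to [2 ^ 2]. *)
  have : (16 ^ l * #|T| < 15 ^ l * 2 ^ (A + B + 2) * #|T|)%N.
    apply: (@leq_ltn_trans (15 ^ l * 'C(d, l))).
      apply: (@leq_trans (16 ^ l * 'C(#|cover T|, l))).
        by rewrite leq_mul2l leq_card_draws ?orbT.
      by apply: leq_expM_bin => i il; lia.
    rewrite -mulnA ltn_pmul2l ?expn_gt0 //; apply: leq_trans cT _.
    by rewrite (expnD 2 (A + B)) -mulnA (mulnCA _ (2 ^ 2)%N) leq_mul2r orbT.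
  have le16 : (15 ^ l * 2 ^ (A + B + 2) <= 16 ^ l)%N.
    by apply: leq_exp15_exp16; lia.
  by rewrite ltnNge leq_mul2r le16 orbT.
(* Here [16 * #|cover S| < d], as the two covers have at most [d] elements together. *)
have cSk : (16 ^ k * #|S| <= 'C(d, k))%N.
  apply: (@leq_trans (16 ^ k * 'C(#|cover S|, k))).
    by rewrite leq_mul2l leq_card_draws ?orbT.
  rewrite -[leqRHS]mul1n -{2}(exp1n k); apply: leq_expM_bin => i ik.
  by lia.
(* Factorwise, [d - i <= 2 * (d - l - i)] because [i < l] and [3 * l < d]. *)
have dk : ('C(d, k) <= 2 ^ k * 'C(d - l, k))%N.
  rewrite -[leqLHS]mul1n -{1}(exp1n k); apply: leq_expM_bin => i ik.
  by lia.
have : (16 ^ k * #|S| <= 2 ^ (k + A.+1) * #|S|)%N.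
  apply: leq_trans cSk (leq_trans dk _).
  by rewrite expnD -mulnA leq_mul2l cS orbT.
(* What remains is [4 * k <= k + A.+1], impossible for [100 * A < k]. *)
by rewrite leq_pmul2r // -[16%N]/(2 ^ 4)%N -expnM leq_exp2l //; lia.
Qed.
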